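(* Let $(X,Y)$ follow the Haver-Winterstein distribution with parameters satisfying $0<\mu_2<0.5$ and $2\mu_2<k$. Let $F_X,F_Y$ be the distribution functions of $X$ and $Y$ and let $F_E(t)=1-e^{-t}$, $t\geq 0$. Then, as $t\to\infty$, $$\mathbb{P}\left\{X>F_X^{-1}[F_E(t)],\ Y>F_Y^{-1}[F_E(t)]\right\}=\exp\left\{-\left(2+\frac{\sigma_1}{\sigma_0}\right)t+O\left(t^{1/2+\mu_2/k}\right)\right\}.$$ Hence the coefficient of asymptotic dependence of $(X,Y)$ is $\chi=0$ and the coefficient of asymptotic independence is $$\eta=\left(2+\frac{\sigma_1}{\sigma_0}\right)^{-1}.$$
   Context: The Haver-Winterstein distribution of $(X,Y)$ on $(0,\infty)^2$ is defined as follows. $X$ has density $$f_X(x)=\begin{cases}\frac{1}{\sqrt{2\pi}\,\alpha x}\exp\left\{-\frac{(\log x-\theta)^2}{2\alpha^2}\right\}, & 0<x\leq u,\\ \frac{k}{\lambda^k}x^{k-1}\exp\left\{-\left(\frac{x}{\lambda}\right)^k\right\}, & x>u,\end{cases}$$ where $u,\alpha,k,\lambda>0$ and $\theta\in\mathbb{R}$ are constrained so that $f_X$ is continuous at $u$ and integrates to $1$. Conditionally on $X=x$, $Y$ is log-normal with density $$f_{Y\mid X}(y\mid x)=\frac{1}{\sqrt{2\pi}\,\sigma(x)y}\exp\left\{-\frac{(\log y-\mu(x))^2}{2\sigma(x)^2}\right\},\quad x,y>0,$$ where $\mu(x)=\mu_0+\mu_1x^{\mu_2}$ and $\sigma(x)=\left[\sigma_0+\sigma_1\exp(-\sigma_2x)\right]^{1/2}$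 with $\mu_0\in\mathbb{R}$ and $\mu_1,\mu_2,\sigma_0,\sigma_1,\sigma_2>0$. For a random vector $(X,Y)$ with marginal distribution functions $F_X,F_Y$, set $\chi(p)=\mathbb{P}\{Y>F_Y^{-1}(p)\mid X>F_X^{-1}(p)\}$ for $p\in(0,1)$. The coefficient of asymptotic dependence is $\chi=\lim_{p\uparrow1}\chi(p)$ and the coefficient of asymptotic independence is $\eta=\lim_{p\uparrow1}\frac{\log(1-p)}{\log[(1-p)\chi(p)]}$. *)

(* Defs.v *)
From HB Require Import structures.
From mathcomp Require Import all_boot all_order all_algebra.
From mathcomp Require Import all_classical all_reals all_analysis.

Set Implicit Arguments.
Unset Strict Implicit.
Unset Printing Implicit Defensive.

Import Order.TTheory GRing.Theory Num.Theory.
Import numFieldNormedType.Exports.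

Local Open Scope classical_set_scope.
Local Open Scope ring_scope.

Definition lognormal_pdf (R : realType) (m s x : R) : R :=
  if 0 < x then
    (Num.sqrt (2 * pi) * s * x)^-1 * expR (- ((ln x - m) ^+ 2 / (2 * s ^+ 2)))
  else 0.

Record hw_param (R : realType) := HWParam {
  hw_u : R; hw_alpha : R; hw_k : R; hw_lambda : R; hw_theta : R;
  hw_mu0 : R; hw_mu1 : R; hw_mu2 : R;
  hw_sigma0 : R; hw_sigma1 : R; hw_sigma2 : R }.

Definition hw_pdfX (R : realType) (w : hw_param R) (x : R) : R :=
  if x <= hw_u w then lognormal_pdf (hw_theta w) (hw_alpha w) x
  else hw_k w / hw_lambda w `^ hw_k w * x `^ (hw_k w - 1)
       * expR (- ((x / hw_lambda w) `^ hw_k w)).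

Definition hw_mu (R : realType) (w : hw_param R) (x : R) : R :=
  hw_mu0 w + hw_mu1 w * x `^ hw_mu2 w.

Definition hw_sigma (R : realType) (w : hw_param R) (x : R) : R :=
  Num.sqrt (hw_sigma0 w + hw_sigma1 w * expR (- (hw_sigma2 w * x))).

(* The value for x <= 0 is irrelevant: X is almost surely positive. *)
Definition hw_pdfYX (R : realType) (w : hw_param R) (x y : R) : R :=
  lognormal_pdf (hw_mu w x) (hw_sigma w x) y.

Record hw_admissible (R : realType) (w : hw_param R) : Prop := HWAdmissible {
  hw_u_gt0 : 0 < hw_u w;
  hw_alpha_gt0 : 0 < hw_alpha w;
  hw_k_gt0 : 0 < hw_k w;
  hw_lambda_gt0 : 0 < hw_lambda w;
  hw_mu1_gt0 : 0 < hw_mu1 w;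
  hw_mu2_gt0 : 0 < hw_mu2 w;
  hw_sigma0_gt0 : 0 < hw_sigma0 w;
  hw_sigma1_gt0 : 0 < hw_sigma1 w;
  hw_sigma2_gt0 : 0 < hw_sigma2 w;
  hw_pdfX_continuous_u : {for hw_u w, continuous (hw_pdfX w)};
  hw_pdfX_integral1 :
    (\int[@lebesgue_measure R]_x (hw_pdfX w x)%:E = 1)%E }.

(* The last field says that x |-> hw_pdfYX w x is the density of a regular
   conditional distribution of Y given X = x. *)
Record haver_winterstein (d : measure_display) (T : measurableType d)
    (R : realType) (P : probability T R) (w : hw_param R)
    (X Y : {RV P >-> R}) : Prop := HaverWinterstein {
  hw_param_admissible : hw_admissible w;
  hw_distributionX : forall A : set R, measurable A ->
    distribution P X A =
    (\int[@lebesgue_measure R]_(x in A) (hw_pdfX w x)%:E)%E;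
  hw_conditionalYX : forall A B : set R, measurable A -> measurable B ->
    P (X @^-1` A `&` Y @^-1` B) =
    (\int[distribution P X]_(x in A)
       \int[@lebesgue_measure R]_(y in B) (hw_pdfYX w x y)%:E)%E }.

Definition quantile (d : measure_display) (T : measurableType d)
    (R : realType) (P : probability T R) (X : {RV P >-> R}) (p : R) : R :=
  inf [set x : R | (p%:E <= cdf X x)%E].

Definition std_exponential_cdf (R : realType) (t : R) : R := 1 - expR (- t).

Definition cond_prob (d : measure_display) (T : measurableType d)
    (R : realType) (P : probability T R) (A B : set T) : R :=
  fine (P (A `&` B)) / fine (P B).

Definition chi_level (d : measure_display) (T : measurableType d)
    (R : realType) (P : probability T R) (X Y : {RV P >-> R}) (p : R) : R :=
  cond_prob P [set z | quantile Y p < Y z] [set z | quantile X p < X z].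

Definition is_asymptotic_dependence_coef (d : measure_display)
    (T : measurableType d) (R : realType) (P : probability T R)
    (X Y : {RV P >-> R}) (chi : R) : Prop :=
  chi_level X Y p @[p --> (1 : R)^'-] --> chi.

Definition is_asymptotic_independence_coef (d : measure_display)
    (T : measurableType d) (R : realType) (P : probability T R)
    (X Y : {RV P >-> R}) (eta : R) : Prop :=
  ln (1 - p) / ln ((1 - p) * chi_level X Y p) @[p --> (1 : R)^'-] --> eta.

(* Lets the Landau notation f =O_+oo g typecheck. *)
Canonical pinfty_filter_on (R : realType) : filter_on R :=
  FilterType (pinfty_nbhs R) (@proper_pinfty_nbhs R).

(* Main.v *)
Require Import Defs.
From HB Require Import structures.
From mathcomp Require Import all_boot all_order all_algebra.
From mathcomp Require Import all_classical all_reals all_analysis.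
From mathcomp Require Import measurable_realfun ring lra.

Set Implicit Arguments.
Unset Strict Implicit.
Unset Printing Implicit Defensive.

Import Order.TTheory GRing.Theory Num.Theory.
Import numFieldNormedType.Exports.

Local Open Scope classical_set_scope.
Local Open Scope ring_scope.

(* Write S = sigma0 + sigma1, m = mu2 / k and a = 1/2 + m < 1. The Weibull tail
   makes the quantile of X at level 1 - e^-t equal to lambda t^(1/k). Given
   X = x, log Y is normal with variance between sigma0 and S and mean O(x^mu2).
   The tail of Y is governed by small X, where the variance is close to S: X is of
   order t^(-1/2) with probability exp(-O((log t)^2)), while X larger than a
   multiple of t^(1/k) is too unlikely to matter and otherwise shifts
   the mean by O(t^m) only. Hence the logarithm of the quantile of Y is
   sqrt(2 S t) + O(t^m). In the joint tail X is of order t^(1/k), so that the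
   variance has dropped to sigma0, and the probability is
   exp(-t) exp(-(2 S t) / (2 sigma0) + O(t^a)), where 1 + S / sigma0 is
   2 + sigma1 / sigma0. *)

(** * Integrals and tails *)

(* Unlike in [ge0_le_integral], neither function has to be measurable: the
   integral of a nonnegative function is a supremum over simple functions. *)
Lemma ge0_le_integral_nomeas d (T : measurableType d) (R : realType)
    (mu : {measure set T -> \bar R}) (D : set T) (f g : T -> \bar R) :
  (forall x, D x -> 0 <= f x)%E -> (forall x, D x -> f x <= g x)%E ->
  (\int[mu]_(x in D) f x <= \int[mu]_(x in D) g x)%E.
Proof.
move=> f0 fg; have fD0 x : (0 <= (f \_ D) x)%E by exact: erestrict_ge0.
have fgD x : ((f \_ D) x <= (g \_ D) x)%E.
  by rewrite !patchE; case: ifPn => // /set_mem; exact: fg.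
rewrite (integral_mkcond D f) (integral_mkcond D g) !ge0_integralTE//.
  apply: ereal_sup_le => _ [h hf <-]; exists h => // x.
  exact: le_trans (hf x) (fgD x).
by move=> x; exact: le_trans (fgD x).
Qed.

(** It is applied both to densities and to the inner integral of the conditional law as a function
    of x. Restricting to a window [A] and using a constant there is the source of all lower bounds
    below. *)
Lemma integral_ge_cst d (T : measurableType d) (R : realType)
    (mu : {measure set T -> \bar R}) (A D : set T) (f : T -> \bar R) (c : R) :
  measurable A -> A `<=` D -> 0 <= c -> (forall x, D x -> 0 <= f x)%E ->
  (forall x, A x -> c%:E <= f x)%E -> (c%:E * mu A <= \int[mu]_(x in D) f x)%E.
Proof.
move=> mA AD c0 f0 cf; rewrite -(integral_cst mu mA) integral_mkcond.
rewrite [leRHS]integral_mkcond; apply: ge0_le_integral_nomeas => x _.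
  by rewrite patchE; case: ifPn => //; rewrite lee_fin.
rewrite !patchE; case: ifPn => [/set_mem Ax|_].
  by rewrite ifT ?inE; [exact: cf|exact: AD].
by case: ifPn => // /set_mem; exact: f0.
Qed.

Lemma integral_le_cst d (T : measurableType d) (R : realType)
    (mu : {measure set T -> \bar R}) (A : set T) (f : T -> \bar R) (c : R) :
  measurable A -> (forall x, A x -> 0 <= f x)%E ->
  (forall x, A x -> f x <= c%:E)%E -> (\int[mu]_(x in A) f x <= c%:E * mu A)%E.
Proof.
by move=> mA f0 fc; rewrite -(integral_cst mu mA); exact: ge0_le_integral_nomeas.
Qed.

(** The integrand is the derivative of -exp(-G), which tends to 0 at infinity, so the fundamental
    theorem of calculus applies. Both the log-normal and the Weibull tail are reduced to this
    form. *)
Lemma integral_oitv_expRN (R : realType) (g G : R -> R) (a : R) :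
  (forall x, a <= x -> 0 <= g x) -> (forall x, a <= x -> {for x, continuous g}) ->
  (forall x, a <= x -> is_derive x 1 G (g x)) -> G x @[x --> +oo] --> +oo ->
  (\int[@lebesgue_measure R]_(x in `]a, +oo[) (g x * expR (- G x))%:E =
   (expR (- G a))%:E)%E.
Proof.
move=> g0 cg dG Goo.
have dF x : a <= x -> is_derive x 1 (fun y => - expR (- G y)) (g x * expR (- G x)).
  move=> ax; have := dG _ ax => dGx.
  have -> : g x * expR (- G x) = - (expR (- G x) * (- g x)) by ring.
  apply: is_deriveN; apply: (@is_derive1_comp R expR (fun y => - G y)).
have cGx x : a <= x -> {for x, continuous G}.
  move=> ax; apply: differentiable_continuous; apply/derivable1_diffP.
  by have := dG _ ax => -[].
have cf x : a <= x -> {for x, continuous (fun x => g x * expR (- G x))}.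
  move=> ax; apply: cvgM; first exact: cg.
  apply: continuous_comp; last exact: continuous_expR.
  by apply: cvgN; exact: cGx.
have cF : {within `[a, +oo[, continuous (fun x => g x * expR (- G x))}.
  apply: continuous_in_subspaceT => x; rewrite inE/= in_itv/= andbT; exact: cf.
(* Passing to the closed end point costs a measurability condition, settled last by continuity. *)
rewrite integral_itv_obnd_cbnd.
  rewrite (@ge0_continuous_FTC2y _ _ (fun y => - expR (- G y)) _ 0).
  - by rewrite -EFinB sub0r opprK.
  - by move=> x ax; rewrite mulr_ge0 ?expR_ge0 ?g0.
  - exact: cF.
  - rewrite -[X in _ --> X]oppr0; apply: cvgN.
    exact: (cvg_comp _ _ Goo (@cvgr_expR R)).
  - by move=> x ax; have [] := dF _ (ltW ax).
  - apply: cvgN; apply: cvg_at_right_filter; apply: continuous_comp; last exact: continuous_expR.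
    by apply: cvgN; exact: cGx.
  - move=> x; rewrite in_itv/= andbT => ax; rewrite derive1E.
    by have [_ ->] := dF _ (ltW ax).
apply/measurable_EFinP; apply: measurable_realfun.open_continuous_measurable_fun => //.
by move=> x; rewrite inE/= in_itv/= andbT => /ltW; exact: cf.
Qed.

(** * Tails of the log-normal and Weibull laws *)

Section lognormal_weibull.
Variable R : realType.
Implicit Types (m s y : R).

Lemma sqrt_2pi_ge1 : 1 <= Num.sqrt (2 * pi) :> R.
Proof.
have pi2 := @pi_ge2 R.
rewrite -[leLHS]sqrtr1 ler_wsqrtr//; lra.
Qed.

Lemma lognormal_pdf_ge0 m s y : 0 <= s -> 0 <= lognormal_pdf m s y.
Proof.
move=> s0; rewrite /lognormal_pdf; case: ifPn => // y0.
by rewrite mulr_ge0 ?expR_ge0// invr_ge0 !mulr_ge0 ?sqrtr_ge0// ltW.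
Qed.

Lemma cvg_lny : ln x @[x --> +oo] --> (+oo : set_system R).
Proof.
apply/cvgryPge => A; near=> x.
by rewrite -(expRK A) ler_ln ?posrE ?expR_gt0.
Unshelve. all: by end_near. Qed.

(** A Mills-type bound: with G the exponent and g = G', the quotient of g exp(-G) by the density is
    sqrt(2 pi) (ln y - m) / s, which is at least 1 because ln y - m >= s. Then g exp(-G) integrates
    exactly. *)
Lemma lognormal_tail_le m s y0 : 0 < s -> 0 < y0 -> s <= ln y0 - m ->
  (\int[@lebesgue_measure R]_(y in `]y0, +oo[) (lognormal_pdf m s y)%:E <=
   (expR (- ((ln y0 - m) ^+ 2 / (2 * s ^+ 2))))%:E)%E.
Proof.
move=> s0 y00 sa.
have lnm y : y0 <= y -> s <= ln y - m.
  by move=> y0y; apply: (le_trans sa); rewrite lerD2r ler_ln ?posrE// (lt_le_trans y00).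
pose g y : R := (ln y - m) / (s ^+ 2 * y).
pose G y : R := (ln y - m) ^+ 2 / (2 * s ^+ 2).
have lnG y : y0 <= y -> is_derive y 1 G (g y).
  move=> y0y; have yp : 0 < y by exact: lt_le_trans y0y.
  have -> : g y = (ln y - m) / s ^+ 2 * y^-1.
    by rewrite /g invfM mulrA.
  apply: (@is_derive1_comp R (fun z => z ^+ 2 / (2 * s ^+ 2)) (fun y => ln y - m)).
    set z := ln y - m.
    have -> : z / s ^+ 2 = (2 * s ^+ 2)^-1 * (z * 1 + z * 1).
      by field; rewrite gt_eqF.
    have -> : (fun z : R => z ^+ 2 / (2 * s ^+ 2)) = (2 * s ^+ 2)^-1 *: ((@id R) * (@id R)).
      by apply/funext => t /=; rewrite mulrC expr2.
    by apply: is_deriveZ; apply: is_deriveM.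
  have := is_derive1_ln yp => ?.
  by rewrite -[y^-1]subr0; apply: is_deriveB.
rewrite -(@integral_oitv_expRN R g G y0) //.
- apply: ge0_le_integral_nomeas => y; rewrite /= in_itv/= andbT => y0y.
    by rewrite lee_fin lognormal_pdf_ge0// ltW.
  have yp : 0 < y by exact: lt_trans y0y.
  rewrite lee_fin /lognormal_pdf yp ler_wpM2r ?expR_ge0//.
  rewrite /g -(mulrA _ s y) (mulrC _ (s * y)) ler_pdivlMr ?mulr_gt0// ?exprn_gt0//.
  have -> : (s * y * Num.sqrt (2 * pi))^-1 * (s ^+ 2 * y) = s / Num.sqrt (2 * pi).
    have := sqrt_2pi_ge1; set z := Num.sqrt _ => z1.
    by field; rewrite !gt_eqF//; lra.
  apply: le_trans (lnm y (ltW y0y)).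
  by rewrite ler_pdivrMr ?(lt_le_trans ltr01 sqrt_2pi_ge1)// ler_peMr ?sqrt_2pi_ge1// ltW.
- move=> y y0y; have yp : 0 < y by exact: lt_le_trans y0y.
  rewrite divr_ge0 ?mulr_ge0 ?sqr_ge0 ?(ltW yp) ?(ltW s0)//.
  by apply: le_trans (lnm y y0y); exact: ltW.
- move=> y y0y; have yp : 0 < y by exact: lt_le_trans y0y.
  apply: cvgM.
    by apply: cvgB; [exact: continuous_ln|exact: cvg_cst].
  apply: cvgV; first by rewrite gt_eqF// mulr_gt0// exprn_gt0.
  by apply: cvgM; [exact: cvg_cst|exact: cvg_id].
- apply/cvgryPge => A; near=> y.
  (* The summand 1 makes ln y - m at least 1, so that its square dominates it; the other summand
     then carries the square past 2 s^2 |A|. *)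
  have h : m + 1 + 2 * s ^+ 2 * `|A| <= ln y.
    by near: y; move/cvgryPge : cvg_lny; apply.
  have s2 : 0 < 2 * s ^+ 2 by rewrite mulr_gt0// exprn_gt0.
  have sA : 0 <= 2 * s ^+ 2 * `|A| by rewrite mulr_ge0// ltW.
  rewrite ler_pdivlMr// (le_trans (_ : _ <= 2 * s ^+ 2 * `|A|))//.
    by rewrite mulrC ler_wpM2l ?ler_norm// ltW.
  have := h; set a := ln y; set b := _ * `|A| => ?.
  have : 1 <= a - m by move: sA; rewrite -/b; lra.
  rewrite expr2; nra.
Unshelve. all: by end_near. Qed.

(** Only the window from y0 to 2 y0 is kept. Its length cancels the factor 1/y up to 1/2, and ln y
    grows by at most ln 2 on it. Lowering m to [m0] makes the bound uniform in the conditioning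
    value later. *)
Lemma lognormal_tail_ge m m0 s y0 : 0 < s -> 0 < y0 -> m0 <= m <= ln y0 ->
  (((2 * Num.sqrt (2 * pi) * s)^-1 *
     expR (- ((ln y0 + ln 2 - m0) ^+ 2 / (2 * s ^+ 2))))%:E <=
  \int[@lebesgue_measure R]_(y in `]y0, +oo[) (lognormal_pdf m s y)%:E)%E.
Proof.
move=> s0 y00 /andP[m0m my0].
set e := expR _.
have sp : 0 < Num.sqrt (2 * pi) :> R by exact: lt_le_trans ltr01 sqrt_2pi_ge1.
have vol : lebesgue_measure `]y0, (2 * y0)] = y0%:E.
  rewrite lebesgue_measure_itv/= lte_fin ifT -?EFinB; last by lra.
  by congr (_%:E); lra.
have -> : (((2 * Num.sqrt (2 * pi) * s)^-1 * e)%:E =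
    ((Num.sqrt (2 * pi) * s * (2 * y0))^-1 * e)%:E * lebesgue_measure `]y0, (2 * y0)%R])%E.
  rewrite vol -EFinM; congr (_%:E); move: sp; set z := Num.sqrt _ => z0.
  by field; rewrite !gt_eqF//; lra.
apply: integral_ge_cst => //.
- by move=> y; rewrite /= !in_itv/= andbT => /andP[].
- by rewrite mulr_ge0 ?expR_ge0// invr_ge0 !mulr_ge0// ltW.
- by move=> y _; rewrite lee_fin lognormal_pdf_ge0// ltW.
move=> y; rewrite /= in_itv/= => /andP[y0y yy0].
have yp : 0 < y by exact: lt_trans y0y.
rewrite lee_fin /lognormal_pdf yp ler_pM ?expR_ge0//.
- by rewrite invr_ge0 !mulr_ge0 ?(ltW sp) ?(ltW s0) ?(ltW y00).
- by rewrite lef_pV2 ?posrE ?mulr_gt0// ler_wpM2l// mulr_ge0 ?(ltW sp) ?(ltW s0).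
rewrite ler_expR lerN2 ler_pM2r ?invr_gt0 ?mulr_gt0 ?exprn_gt0//.
have h1 : ln y0 <= ln y by rewrite ler_ln ?posrE// ltW.
have h2 : ln y <= ln y0 + ln 2.
  by rewrite -lnM ?posrE// ler_ln ?posrE ?mulr_gt0// mulrC.
rewrite ler_pXn2r ?nnegrE//; lra.
Qed.

Lemma weibull_tail (k l x : R) : 0 < k -> 0 < l -> 0 < x ->
  (\int[@lebesgue_measure R]_(y in `]x, +oo[)
     (k / l `^ k * y `^ (k - 1) * expR (- ((y / l) `^ k)))%:E =
   (expR (- ((x / l) `^ k)))%:E)%E.
Proof.
move=> k0 l0 x0.
apply: (@integral_oitv_expRN R (fun y => k / l `^ k * y `^ (k - 1)) (fun y => (y / l) `^ k) x).
- by move=> y xy; rewrite mulr_ge0 ?powR_ge0// divr_ge0 ?powR_ge0// ltW.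
- move=> y xy; have yp : 0 < y by exact: lt_le_trans xy.
  have cp : {for y, continuous (fun z : R => z `^ (k - 1))}.
    apply: differentiable_continuous; apply/derivable1_diffP.
    by have [] := is_derive1_powR (k - 1) yp.
  by apply: cvgM; [exact: cvg_cst|exact: cp].
- move=> y xy; have yp : 0 < y by exact: lt_le_trans xy.
  have -> : k / l `^ k * y `^ (k - 1) = k * (y / l) `^ (k - 1) * l^-1.
    rewrite powRM ?invr_ge0 ?(ltW yp) ?(ltW l0)// -!mulrA; congr (_ * _).
    have -> : l^-1 = l `^ (- 1) by rewrite powR_inv1// ltW.
    rewrite -powRrM -powRD ?(gt_eqF l0) ?implybT// -powRN.
    rewrite mulrC; congr (_ * powR l _); ring.
  apply: (@is_derive1_comp R (fun z => z `^ k) (fun y => y / l)).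
    by apply: is_derive1_powR; rewrite divr_gt0.
  have -> : (fun y => y / l) = l^-1 *: (@id R) by apply/funext => t /=; rewrite mulrC.
  by rewrite -[X in is_derive _ _ _ X]mulr1; apply: is_deriveZ.
apply/cvgryPge => A; near=> y.
have h : l * (`|A| `^ (k^-1)) <= y by [].
rewrite (le_trans (ler_norm A))//.
have -> : `|A| = (`|A| `^ k^-1) `^ k by rewrite -powRrM mulVf ?gt_eqF// powRr1.
have y0 : 0 <= y by apply: le_trans h; rewrite mulr_ge0 ?powR_ge0// ltW.
apply: ge0_ler_powR; rewrite ?nnegrE ?powR_ge0 ?(ltW k0)//.
  by rewrite divr_ge0// ltW.
by rewrite ler_pdivlMr// mulrC.
Unshelve. all: by end_near. Qed.

End lognormal_weibull.

(** * Quantiles and the bivariate law *)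

Section quantile.
Context d (T : measurableType d) (R : realType) (P : probability T R).
Variable X : {RV P >-> R}.
Implicit Types p x : R.

(** The infimum is meaningful only over a set bounded below; this follows from p > 0, as the
    distribution function vanishes at minus infinity. *)
Lemma quantile_le p x : 0 < p -> (p%:E <= cdf X x)%E -> quantile X p <= x.
Proof.
move=> p0 px; apply: ge_inf => //.
have p0E : (0%:E < p%:E)%E by rewrite lte_fin.
have [M [_ HM]] := @cvg_cdfNy0 _ _ _ _ X _ (open_ereal_lt' p0E).
exists (M - 1) => z /=; apply: contraTle => zM; rewrite -ltNge.
by apply: HM; rewrite (lt_trans zM)// ltrBlDr ltrDl.
Qed.

(** Here p < 1 gives nonemptiness of the set, as the distribution function tends to 1. *)
Lemma quantile_ge p x : p < 1 -> (forall z, z < x -> (cdf X z < p%:E)%E) ->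
  x <= quantile X p.
Proof.
move=> p1 px; apply: lb_le_inf.
  have p1E : (p%:E < 1%:E)%E by rewrite lte_fin.
  have [M [_ HM]] := @cvg_cdfy1 _ _ _ _ X _ (open_ereal_gt' p1E).
  exists (M + 1); apply: ltW; apply: HM.
  by rewrite ltrDl.
by move=> z /=; apply: contraTle => /px; rewrite ltNge.
Qed.

End quantile.

(** * Consequences of the conditional density for the law of (X, Y) *)

Section hw.
Context d (T : measurableType d) (R : realType) (P : probability T R).
Variables (w : hw_param R) (X Y : {RV P >-> R}).
Hypothesis hXY : haver_winterstein w X Y.

(** Real values let all later estimates be done by real arithmetic; [prX_fin] and [prXY_fin] return
    to the measure. *)
Definition prX (A : set R) : R := fine (P (X @^-1` A)).
Definition prXY (A : set R) (y : R) : R := fine (P (X @^-1` A `&` Y @^-1` `]y, +oo[)).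

Let adm : hw_admissible w := hw_param_admissible hXY.

Lemma hw_var_gt0 x : hw_sigma0 w < hw_sigma0 w + hw_sigma1 w * expR (- (hw_sigma2 w * x)).
Proof. by rewrite ltrDl mulr_gt0 ?expR_gt0//; have := hw_sigma1_gt0 adm. Qed.

Lemma hw_sigma_gt0 x : 0 < hw_sigma w x.
Proof. by rewrite sqrtr_gt0; apply: lt_trans (hw_var_gt0 x); exact: hw_sigma0_gt0. Qed.

Lemma hw_sigma_sqr x : hw_sigma w x ^+ 2 = hw_sigma0 w + hw_sigma1 w * expR (- (hw_sigma2 w * x)).
Proof. by rewrite sqr_sqrtr// ltW//; apply: lt_trans (hw_var_gt0 x); exact: hw_sigma0_gt0. Qed.

Lemma hw_mu_ge x : hw_mu0 w <= hw_mu w x.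
Proof. by rewrite lerDl mulr_ge0 ?powR_ge0// ltW// hw_mu1_gt0. Qed.

Lemma measurable_preX (A : set R) : measurable A -> measurable (X @^-1` A).
Proof. by move=> mA; rewrite -[_ @^-1` _]setTI; exact: measurable_funP. Qed.


Lemma prX_fin (A : set R) : measurable A -> P (X @^-1` A) = (prX A)%:E.
Proof. by move=> mA; rewrite fineK// fin_num_measure//; exact: measurable_preX. Qed.

Lemma measurable_preXY (A : set R) (y : R) : measurable A ->
  measurable (X @^-1` A `&` Y @^-1` `]y, +oo[).
Proof.
move=> mA; apply: measurableI; first exact: measurable_preX.
by rewrite -[_ @^-1` _]setTI; exact: measurable_funP.
Qed.

Lemma prXY_fin (A : set R) y : measurable A -> P (X @^-1` A `&` Y @^-1` `]y, +oo[) = (prXY A y)%:E.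
Proof. by move=> mA; rewrite fineK// fin_num_measure//; exact: measurable_preXY. Qed.

Lemma prX_le A B : measurable A -> measurable B -> A `<=` B -> prX A <= prX B.
Proof.
move=> mA mB AB; rewrite -lee_fin -!prX_fin//; apply: le_measure; rewrite ?inE.
- exact: measurable_preX.
- exact: measurable_preX.
- by move=> z; exact: AB.
Qed.

Lemma prX_le1 A : measurable A -> prX A <= 1.
Proof.
by move=> mA; rewrite -lee_fin -prX_fin//; apply: probability_le1; exact: measurable_preX.
Qed.

Lemma prX_le_split A B C : measurable A -> measurable B -> measurable C ->
  A `<=` B `|` C -> prX A <= prX B + prX C.
Proof.
move=> mA mB mC ABC; rewrite -lee_fin EFinD -!prX_fin//.
apply: le_trans (measureU2 _ _ _).
- apply: le_measure; rewrite ?inE.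
  + exact: measurable_preX.
  + by apply: measurableU; exact: measurable_preX.
  + by move=> z /ABC.
- exact: measurable_preX.
- exact: measurable_preX.
Qed.

Lemma prXY_le A B x y : measurable A -> measurable B -> A `<=` B -> y <= x ->
  prXY A x <= prXY B y.
Proof.
move=> mA mB AB yx; rewrite -lee_fin -!prXY_fin//; apply: le_measure; rewrite ?inE.
- exact: measurable_preXY.
- exact: measurable_preXY.
- move=> z [/AB Bz]; rewrite /= !in_itv/= !andbT => xz; split => //=.
  exact: le_lt_trans xz.
Qed.

(** The event on Y is dropped over [B]: this discards the values of X so large that the Weibull tail
    alone is small enough. *)
Lemma prXY_le_split A B C y : measurable A -> measurable B -> measurable C ->
  A `<=` B `|` C -> prXY A y <= prX B + prXY C y.
Proof.
move=> mA mB mC ABC; rewrite -lee_fin EFinD -prX_fin -?prXY_fin//.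
apply: le_trans (measureU2 _ _ _).
- apply: le_measure; rewrite ?inE.
  + exact: measurable_preXY.
  + by apply: measurableU; [exact: measurable_preX|exact: measurable_preXY].
  + by move=> z [/ABC [Bz|Cz] Yz]; [left|right].
- exact: measurable_preX.
- exact: measurable_preXY.
Qed.

(** The upper log-normal tail bound grows with both variance and mean, so the worst values [V] and
    [M] over [A] bound the inner integral for every x. The condition on sqrt V makes
    [lognormal_tail_le] applicable throughout [A]. *)
Lemma prXY_le_tail A y (V M : R) : measurable A -> 0 < V ->
  (forall x, A x -> hw_sigma w x ^+ 2 <= V) -> (forall x, A x -> hw_mu w x <= M) ->
  Num.sqrt V <= ln y - M -> 0 < y ->
  prXY A y <= expR (- ((ln y - M) ^+ 2 / (2 * V))) * prX A.
Proof.
move=> mA V0 sV muM Va y0; rewrite -lee_fin EFinM -prXY_fin// -prX_fin//.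
rewrite (hw_conditionalYX hXY)//.
apply: integral_le_cst => // x Ax.
  by apply: integral_ge0 => z _; rewrite lee_fin lognormal_pdf_ge0// ltW// hw_sigma_gt0.
have sx := hw_sigma_gt0 x; have mx := muM x Ax.
have a0 : 0 <= ln y - M by apply: le_trans Va; exact: sqrtr_ge0.
have s2 : hw_sigma w x <= Num.sqrt V.
  by rewrite -(ger0_norm (ltW sx)) -sqrtr_sqr ler_wsqrtr// sV.
have h : ln y - M <= ln y - hw_mu w x by rewrite lerB.
apply: le_trans (lognormal_tail_le sx y0 (le_trans s2 (le_trans Va h))) _.
rewrite lee_fin ler_expR lerN2 ler_pM ?sqr_ge0 ?invr_ge0 ?mulr_ge0 ?(ltW V0)//.
  by rewrite ler_pXn2r// nnegrE//; exact: le_trans h.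
by rewrite lef_pV2 ?posrE ?mulr_gt0 ?exprn_gt0// ler_pM2l// sV.
Qed.

(** Two variance bounds are needed: the prefactor is smallest at the upper one [V], the exponential
    at the lower one [W]. *)
Lemma prXY_ge_tail A y (V W : R) : measurable A -> 0 < W -> 0 < y ->
  (forall x, A x -> W <= hw_sigma w x ^+ 2 <= V) -> (forall x, A x -> hw_mu w x <= ln y) ->
  (2 * Num.sqrt (2 * pi) * Num.sqrt V)^-1 * expR (- ((ln y + ln 2 - hw_mu0 w) ^+ 2 / (2 * W)))
    * prX A <= prXY A y.
Proof.
move=> mA W0 y0 sV muM; rewrite -lee_fin EFinM -prXY_fin// -prX_fin//.
rewrite (hw_conditionalYX hXY)//.
have sp : 0 < Num.sqrt (2 * pi) :> R by exact: lt_le_trans ltr01 (sqrt_2pi_ge1 R).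
apply: integral_ge_cst => //.
- by move=> x Ax; apply: integral_ge0 => z _; rewrite lee_fin lognormal_pdf_ge0// ltW// hw_sigma_gt0.
move=> x Ax; have sx := hw_sigma_gt0 x; have mx := muM x Ax; have /andP[WV sxV] := sV x Ax.
have V0 : 0 < V by apply: lt_le_trans sxV; rewrite exprn_gt0.
have s2 : hw_sigma w x <= Num.sqrt V.
  by rewrite -(ger0_norm (ltW sx)) -sqrtr_sqr ler_wsqrtr.
apply: le_trans (@lognormal_tail_ge _ (hw_mu w x) (hw_mu0 w) (hw_sigma w x) y sx y0 _); last first.
  by rewrite hw_mu_ge.
rewrite lee_fin ler_pM ?expR_ge0 ?invr_ge0 ?mulr_ge0 ?sqrtr_ge0//.
- have V1 : 0 < Num.sqrt V by rewrite sqrtr_gt0.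
  by rewrite lef_pV2 ?posrE ?mulr_gt0// ler_wpM2l// mulr_ge0// ltW.
- rewrite ler_expR lerN2 ler_wpM2l ?sqr_ge0// lef_pV2 ?posrE ?mulr_gt0 ?exprn_gt0// ler_pM2l//.
Qed.

Lemma prX_tail x : hw_u w <= x -> prX `]x, +oo[ = expR (- ((x / hw_lambda w) `^ hw_k w)).
Proof.
move=> ux; apply: EFin_inj; rewrite -prX_fin//.
have := hw_distributionX hXY (A := `]x, +oo[); rewrite /distribution /pushforward => ->//.
rewrite -(weibull_tail (hw_k_gt0 adm) (hw_lambda_gt0 adm)); last first.
  exact: lt_le_trans (hw_u_gt0 adm) ux.
apply: eq_integral => z; rewrite inE/= in_itv/= andbT => xz.
by rewrite /hw_pdfX leNgt (le_lt_trans ux xz).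
Qed.

(** Nonpositive values must be split off, since for negative x the conditional variance exceeds
    sigma0 + sigma1. *)
Lemma prX_nonpos : prX `]-oo, 0] = 0.
Proof.
apply: EFin_inj; rewrite -prX_fin//.
have := hw_distributionX hXY (A := `]-oo, 0]); rewrite /distribution /pushforward => ->//.
apply: integral0_eq => z; rewrite /= in_itv/= => z0.
rewrite /hw_pdfX (le_trans z0 (ltW (hw_u_gt0 adm))) /lognormal_pdf ltNge z0//.
Qed.

(** The window lies in the log-normal part of the density and its logarithms lie below theta, so the
    exponent is worst at the left end t. The length t cancels the factor 1/y up to 1/2. *)
Lemma prX_small (t : R) : 0 < t -> 2 * t <= hw_u w -> ln (2 * t) <= hw_theta w ->
  (2 * Num.sqrt (2 * pi) * hw_alpha w)^-1 *
    expR (- ((ln t - hw_theta w) ^+ 2 / (2 * hw_alpha w ^+ 2))) <= prX `]t, (2 * t)].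
Proof.
move=> t0 tu lt.
rewrite -lee_fin -prX_fin//.
have := hw_distributionX hXY (A := `]t, (2 * t)]); rewrite /distribution /pushforward => ->//.
set e := expR _.
have sp : 0 < Num.sqrt (2 * pi) :> R by exact: lt_le_trans ltr01 (sqrt_2pi_ge1 R).
have a0 := hw_alpha_gt0 adm.
have vol : lebesgue_measure `]t, (2 * t)] = t%:E.
  rewrite lebesgue_measure_itv/= lte_fin ifT -?EFinB; last by lra.
  by congr (_%:E); lra.
have -> : (((2 * Num.sqrt (2 * pi) * hw_alpha w)^-1 * e)%:E =
    ((Num.sqrt (2 * pi) * hw_alpha w * (2 * t))^-1 * e)%:E * lebesgue_measure `]t, (2 * t)%R])%E.
  rewrite vol -EFinM; congr (_%:E); move: sp; set z := Num.sqrt _ => z0.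
  by field; rewrite !gt_eqF//; lra.
have pdf0 y : `]t, (2 * t)]%classic y -> (0 <= (hw_pdfX w y)%:E)%E.
  rewrite /= in_itv/= => /andP[ty y2].
  by rewrite /hw_pdfX (le_trans y2 tu) lee_fin lognormal_pdf_ge0// ltW.
apply: integral_ge_cst => //.
  by rewrite mulr_ge0 ?expR_ge0// invr_ge0 !mulr_ge0// ltW.
move=> y; rewrite /= in_itv/= => /andP[ty y2].
have yp : 0 < y by exact: lt_trans ty.
rewrite lee_fin /hw_pdfX (le_trans y2 tu) /lognormal_pdf yp ler_pM ?expR_ge0//.
- by rewrite invr_ge0 !mulr_ge0 ?(ltW sp) ?(ltW a0) ?(ltW t0).
- by rewrite lef_pV2 ?posrE ?mulr_gt0// ler_wpM2l// mulr_ge0 ?(ltW sp) ?(ltW a0).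
rewrite ler_expR lerN2 ler_pM2r ?invr_gt0 ?mulr_gt0 ?exprn_gt0//.
have h1 : ln t <= ln y by rewrite ler_ln ?posrE// ltW.
have h2 : ln y <= ln (2 * t) by rewrite ler_ln ?posrE ?mulr_gt0.
rewrite -[leLHS]sqrrN -[leRHS]sqrrN ler_pXn2r ?nnegrE//; lra.
Qed.

Lemma cdf_prX x : cdf X x = (1 - prX `]x, +oo[)%:E.
Proof.
rewrite cdf_1_ccdf /ccdf EFinB; congr (_ - _)%E; exact: prX_fin.
Qed.

Lemma cdf_prY x : cdf Y x = (1 - prXY setT x)%:E.
Proof.
rewrite cdf_1_ccdf /ccdf EFinB -prXY_fin// preimage_setT setTI; congr (_ - _)%E.
Qed.

(** The hypothesis says that the quantile lies beyond u, where the Weibull tail can be inverted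
    explicitly. *)
Lemma quantile_hwX t : (hw_u w / hw_lambda w) `^ hw_k w < t ->
  quantile X (std_exponential_cdf t) = hw_lambda w * t `^ (hw_k w)^-1.
Proof.
move=> ut; have k0 := hw_k_gt0 adm; have l0 := hw_lambda_gt0 adm; have u0 := hw_u_gt0 adm.
have t0 : 0 < t by apply: le_lt_trans ut; exact: powR_ge0.
have ul : 0 <= hw_u w / hw_lambda w by rewrite divr_ge0 ?ltW.
have e1 : expR (- t) < 1 by rewrite expR_lt1 oppr_lt0.
have xk : ((hw_lambda w * t `^ (hw_k w)^-1) / hw_lambda w) `^ hw_k w = t.
  by rewrite mulrAC divff ?gt_eqF// mul1r -powRrM mulVf ?gt_eqF// powRr1// ltW.
have ux : hw_u w < hw_lambda w * t `^ (hw_k w)^-1.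
  rewrite -ltr_pdivrMl// mulrC.
  have <- : ((hw_u w / hw_lambda w) `^ hw_k w) `^ (hw_k w)^-1 = hw_u w / hw_lambda w.
    by rewrite -powRrM divff ?gt_eqF// powRr1.
  by rewrite gt0_ltr_powR// ?nnegrE ?invr_gt0 ?powR_ge0// ltW.
apply/le_anti/andP; split.
  apply: quantile_le; first by rewrite subr_gt0.
  by rewrite cdf_prX prX_tail ?(ltW ux)// xk.
apply: quantile_ge; first by rewrite gtrBl expR_gt0.
move=> z zx; rewrite cdf_prX lte_fin ltrD2l ltrN2.
(* The tail formula holds only from u on, hence the maximum; it is still strictly below the claimed
   quantile. *)
apply: lt_le_trans (_ : prX `](Num.max (hw_u w) z), +oo[ <= _).
  rewrite prX_tail ?le_max ?lexx// ltr_expR ltrN2 -[ltRHS]xk.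
  rewrite gt0_ltr_powR// ?nnegrE ?divr_ge0 ?mulr_ge0 ?powR_ge0 ?le_max ?(ltW u0) ?(ltW l0)//.
  by rewrite ltr_pM2r ?invr_gt0// gt_max ux.
apply: prX_le => // y; rewrite /= !in_itv/= !andbT.
by apply: le_lt_trans; rewrite le_max lexx orbT.
Qed.

End hw.

(** * Asymptotics *)

Section growth.
Variable R : realType.
Implicit Types a b c : R.

Lemma near_le_powR a c : 0 < a -> \forall t \near +oo, c <= t `^ a.
Proof.
move=> a0; near=> t.
have h : `|c| `^ a^-1 <= t by [].
rewrite (le_trans (ler_norm c))//.
have -> : `|c| = (`|c| `^ a^-1) `^ a by rewrite -powRrM mulVf ?gt_eqF// powRr1.
apply: ge0_ler_powR; rewrite ?nnegrE ?powR_ge0 ?(ltW a0)//.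
Unshelve. all: by end_near. Qed.

Lemma near_powR_le_powR a b c : a < b -> \forall t \near +oo, c * t `^ a <= t `^ b.
Proof.
move=> ab; near=> t.
have t0 : 0 < t by [].
have -> : b = (b - a) + a by rewrite subrK.
rewrite powRD ?(gt_eqF t0) ?implybT// ler_wpM2r ?powR_ge0//.
by near: t; apply: near_le_powR; rewrite subr_gt0.
Unshelve. all: by end_near. Qed.

Lemma near_ln_le_powR a c : 0 < a -> \forall t \near +oo, c * ln t <= t `^ a.
Proof.
move=> a0; have a20 : 0 < a / 2 by rewrite divr_gt0.
near=> t.
have t1 : 1 <= t by [].
have t0 : 0 < t by apply: lt_le_trans t1.
have l0 : 0 <= ln t by exact: ln_ge0.
apply: (@le_trans _ _ (`|c| * ln t)); first by rewrite ler_wpM2r ?ler_norm.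
(* Sublinearity of ln is applied to t^(a/2); the other half of the exponent absorbs the
   constants. *)
have h : ln t <= (a / 2)^-1 * t `^ (a / 2).
  by rewrite ler_pdivlMl// -ln_powR ltW// ln_sublinear// powR_gt0.
apply: (@le_trans _ _ (`|c| * (a / 2)^-1 * t `^ (a / 2))).
  by rewrite -mulrA ler_wpM2l.
near: t; apply: near_powR_le_powR; lra.
Unshelve. all: by end_near. Qed.

Lemma two_le_expR1 : 2 <= expR 1 :> R.
Proof. by have := expR_ge1Dx (1 : R); rewrite -natr1. Qed.

(** Keeps union bounds in exponential form: adding two equal terms costs one unit in the
    exponent. *)
Lemma expR_double_le a : expR a + expR a <= expR (a + 1).
Proof. by rewrite expRD -mulr2n -mulr_natr ler_wpM2l ?expR_ge0// two_le_expR1. Qed.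

End growth.

(* Below [h], [z], [b] stand for t^(1/2), t^m and sqrt (2 S), with m as in the
   header; [h * z] is then the size of the error term. *)
Section exponent_estimates.
Variables (R : realType).
Implicit Types S b h z t W g q B K E e : R.

(** For the regime of small X, where the variance is [W], just below [S]. Squaring b h - z/2 gains a
    multiple of h z from the cross term, while dividing by 2 W instead of 2 S loses only a multiple
    of h. *)
Lemma exponent_le_inflated S b h z t W g q : 0 < S -> 0 < b -> 0 < h -> 0 < z ->
  h * h = t -> b * b = 2 * S -> z <= b * h / 2 -> 0 <= q -> q <= b * h - z / 2 ->
  0 <= g -> W = S - g * h^-1 -> S / 2 <= W ->
  q ^+ 2 / (2 * W) <= t + 2 * g / S * h - b / (4 * S) * (h * z).
Proof.
move=> S0 b0 h0 z0 ht bb zb q0 qb g0 WE SW.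
have W0 : 0 < W by lra.
have WS : W <= S by rewrite WE gerBl mulr_ge0 ?invr_ge0 ?(ltW h0).
have Wt : W * t = S * t - g * h by rewrite WE -ht; field; rewrite gt_eqF.
rewrite ler_pdivrMr ?mulr_gt0// expr2.
have q2 : q * q <= 2 * S * t - b / 2 * (h * z).
  have e1 : q * q <= (b * h - z / 2) * (b * h - z / 2) by apply: ler_pM.
  have e2 : b * h * (b * h) = 2 * S * t by rewrite -ht -bb; ring.
  have hz : z * z <= z * (b * h / 2) by rewrite ler_pM2l.
  nra.
apply: (le_trans q2).
have hz : 0 <= h * z by rewrite mulr_ge0 ?ltW.
have e3 : b / (4 * S) * (h * z) * (2 * W) <= b / 2 * (h * z).
  have -> : b / (4 * S) * (h * z) * (2 * W) = b / 2 * (h * z) * (W / S).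
    by field; rewrite gt_eqF.
  apply: ler_piMr; last by rewrite ler_pdivrMr// mul1r.
  by rewrite mulr_ge0// divr_ge0// ltW.
have e4 : 2 * g * h <= 2 * g / S * h * (2 * W).
  have -> : 2 * g / S * h * (2 * W) = 2 * g * h * (2 * W / S).
    by field; rewrite gt_eqF.
  apply: ler_peMr; first by rewrite !mulr_ge0// ltW.
  rewrite ler_pdivlMr//; lra.
nra.
Qed.

(** For the lower bound on the joint tail, with the least variance [s0]. The square of b h gives 2
    (s0 + s1) t, and all other terms are at most multiples of h z. *)
Lemma exponent_le (s0 s1 : R) b h z t B K q : 0 < s0 -> 0 < s1 -> 0 < b -> 0 < h -> 0 < z ->
  h * h = t -> b * b = 2 * (s0 + s1) -> 0 <= B -> `|K| <= z -> z * z <= h * z ->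
  q = b * h + B * z + K -> 0 <= q ->
  q ^+ 2 / (2 * s0) <= (1 + s1 / s0) * t + (2 * (B + 1) * b + (B + 1) ^+ 2) / (2 * s0) * (h * z).
Proof.
move=> s00 s10 b0 h0 z0 ht bb B0 Kz zz qE q0.
have -> : (1 + s1 / s0) * t + (2 * (B + 1) * b + (B + 1) ^+ 2) / (2 * s0) * (h * z) =
  (2 * (s0 + s1) * t + (2 * (B + 1) * b + (B + 1) ^+ 2) * (h * z)) / (2 * s0).
  by field; rewrite gt_eqF.
rewrite ler_pM2r ?invr_gt0 ?mulr_gt0//.
have qb : q <= b * h + (B + 1) * z by have := ler_norm K; lra.
have e1 : q * q <= (b * h + (B + 1) * z) * (b * h + (B + 1) * z) by apply: ler_pM.
have e2 : b * h * (b * h) = 2 * (s0 + s1) * t by rewrite -ht -bb; ring.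
have e3 : (B + 1) ^+ 2 * (z * z) <= (B + 1) ^+ 2 * (h * z) by rewrite ler_wpM2l ?sqr_ge0.
rewrite expr2 in e3 *; rewrite expr2; nra.
Qed.

(** For the upper bound on the joint tail, where [e] is the remaining decay factor of the variance.
    In the error constant, the first summand pays for the excess variance s1 e through e t <= h z,
    the second for the cross term of the square. *)
Lemma exponent_ge (s0 s1 : R) b h z t E e q : 0 < s0 -> 0 < s1 -> 0 < b -> 0 < h -> 0 < z ->
  h * h = t -> b * b = 2 * (s0 + s1) -> 0 <= E -> 0 <= e -> e * t <= h * z ->
  0 <= b * h - E * z -> b * h - E * z <= q ->
  (1 + s1 / s0) * t - (s1 / s0 * (1 + s1 / s0) + E * b / s0) * (h * z) <=
  q ^+ 2 / (2 * (s0 + s1 * e)).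
Proof.
move=> s00 s10 b0 h0 z0 ht bb E0 e0 et hE qE.
have V0 : 0 < s0 + s1 * e by rewrite ltr_wpDr// mulr_ge0// ltW.
rewrite ler_pdivlMr ?mulr_gt0//.
have e1 : (b * h - E * z) * (b * h - E * z) <= q * q by apply: ler_pM.
have e2 : b * h * (b * h) = 2 * (s0 + s1) * t by rewrite -ht -bb; ring.
have hz : 0 <= h * z by rewrite mulr_ge0 ?ltW.
have -> : ((1 + s1 / s0) * t - (s1 / s0 * (1 + s1 / s0) + E * b / s0) * (h * z)) *
    (2 * (s0 + s1 * e)) =
    2 * (s0 + s1) * t - 2 * (s1 * (1 + s1 / s0) * (h * z - e * t) + E * b * (h * z)) -
      2 * (s1 * e / s0) * ((s1 * (1 + s1 / s0) + E * b) * (h * z)).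
  by field; rewrite gt_eqF.
set k := s1 / s0; have k0 : 0 < k by exact: divr_gt0.
have e3 : 0 <= s1 * (1 + k) * (h * z - e * t).
  by rewrite mulr_ge0 ?subr_ge0// mulr_ge0 ?ltW// addr_gt0.
have e4 : 0 <= s1 * e / s0 * ((s1 * (1 + k) + E * b) * (h * z)).
  have ? := ltW k0; have ? := ltW s10; have ? := ltW s00; have ? := ltW b0.
  apply: mulr_ge0; first by rewrite divr_ge0// mulr_ge0.
  by rewrite mulr_ge0// addr_ge0// mulr_ge0// addr_ge0.
rewrite expr2; nra.
Qed.

End exponent_estimates.

(** * Bounds on the tail of Y and on the joint tail *)

Section hw_asymptotics.
Context d (T : measurableType d) (R : realType) (P : probability T R).
Variables (w : hw_param R) (X Y : {RV P >-> R}).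
Hypothesis hXY : haver_winterstein w X Y.
Hypothesis hmu2_k : 2 * hw_mu2 w < hw_k w.

Let adm : hw_admissible w := hw_param_admissible hXY.
Let S := hw_sigma0 w + hw_sigma1 w.
Let r := hw_sigma1 w / hw_sigma0 w.
Let m := hw_mu2 w / hw_k w.
(* Eventually [xq t] is the quantile of X at level 1 - e^-t, and
   [q2S * t `^ (1 / 2)] is the leading term of the logarithm of that of Y. *)
Let q2S := Num.sqrt (2 * S).
(** Times t^m, this is the value of mu1 x^mu2 at x = lambda (N t)^(1/k). *)
Let D N := hw_mu1 w * hw_lambda w `^ hw_mu2 w * N `^ m.
Let xq t := hw_lambda w * t `^ (hw_k w)^-1.
Let s0_gt0 := hw_sigma0_gt0 adm.
Let s1_gt0 := hw_sigma1_gt0 adm.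
Let k_gt0 := hw_k_gt0 adm.
Let l_gt0 := hw_lambda_gt0 adm.

Lemma S_gt0 : 0 < S. Proof. by rewrite addr_gt0. Qed.

Lemma q2S_gt0 : 0 < q2S. Proof. by rewrite sqrtr_gt0 mulr_gt0// S_gt0. Qed.

Lemma q2S_sqr : q2S * q2S = 2 * S.
Proof. by rewrite -expr2 sqr_sqrtr// mulr_ge0// ltW// S_gt0. Qed.

Lemma m_gt0 : 0 < m. Proof. by rewrite divr_gt0 ?hw_mu2_gt0. Qed.

(** Makes t^m negligible against t^(1/2), and the error t^(1/2 + m) negligible against t. *)
Lemma m_lt : m < 1 / 2.
Proof. rewrite ltr_pdivrMr//.
move: hmu2_k; set a := hw_mu2 w; set b := hw_k w. lra. Qed.

Lemma powR_half_m (t : R) : 0 < t -> t `^ (1 / 2 + m) = t `^ (1 / 2) * t `^ m.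
Proof. by move=> t0; rewrite powRD// (gt_eqF t0) implybT. Qed.

Lemma powR_half_sqr (t : R) : 0 < t -> t `^ (1 / 2) * t `^ (1 / 2) = t.
Proof.
move=> t0; rewrite -powRD ?(gt_eqF t0) ?implybT//.
by rewrite (_ : 1 / 2 + 1 / 2 = 1 :> R) ?powRr1 ?ltW//; lra.
Qed.

Lemma near_sqr_powR_m c : \forall t \near +oo, c * (t `^ m * t `^ m) <= t `^ (1 / 2 + m).
Proof.
near=> t; have t0 : 0 < t by [].
rewrite -powRD ?(gt_eqF t0) ?implybT//.
near: t; apply: near_powR_le_powR; have := m_lt; lra.
Unshelve. all: by end_near. Qed.

Lemma xq_tail t : 0 < t -> hw_u w <= xq t -> prX X `]xq t, +oo[ = expR (- t).
Proof.
move=> t0 ux; rewrite (prX_tail hXY)// /xq mulrAC divff ?gt_eqF// mul1r.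
by rewrite -powRrM mulVf ?gt_eqF// powRr1// ltW.
Qed.

Lemma near_u_le_xq c : 0 < c -> \forall t \near +oo, hw_u w <= xq (c * t).
Proof.
move=> c0; near=> t; have t0 : 0 < t by [].
rewrite /xq powRM ?(ltW c0) ?(ltW t0)// mulrA mulrC -ler_pdivrMr; last first.
  by rewrite mulr_gt0// powR_gt0.
by near: t; apply: near_le_powR; rewrite invr_gt0.
Unshelve. all: by end_near. Qed.

(** The exponent m arises here, as (t^(1/k))^mu2. *)
Lemma hw_mu_le_xq N t x : 0 < N -> 0 < t -> 0 < x -> x <= xq (N * t) ->
  hw_mu w x <= hw_mu0 w + D N * t `^ m.
Proof.
move=> N0 t0 x0 xx; rewrite lerD2l /D -!mulrA ler_wpM2l ?(ltW (hw_mu1_gt0 adm))//.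
rewrite -[N `^ _ * _]powRM ?(ltW N0) ?(ltW t0)//.
have -> : (N * t) `^ m = ((N * t) `^ (hw_k w)^-1) `^ hw_mu2 w.
  by rewrite -powRrM [_^-1 * _]mulrC.
rewrite -powRM ?powR_ge0 ?(ltW l_gt0)//.
apply: ge0_ler_powR; rewrite ?nnegrE ?(ltW x0)//.
- by rewrite ltW// hw_mu2_gt0.
- by rewrite mulr_ge0 ?powR_ge0// ltW.
Qed.

Lemma D_ge0 N : 0 <= D N.
Proof. by rewrite !mulr_ge0 ?powR_ge0// ltW// hw_mu1_gt0. Qed.

Lemma hw_sigma_sqr_le x : 0 <= x -> hw_sigma w x ^+ 2 <= S.
Proof.
move=> x0; rewrite (hw_sigma_sqr hXY) lerD2l ler_piMr ?(ltW s1_gt0)//.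
by rewrite expR_le1 oppr_le0 mulr_ge0// ltW// hw_sigma2_gt0.
Qed.

(** Values of X beyond [xq (2 * t)] have probability exp(-2 t). Below, the mean is at most mu0 + D 2
    t^m and the variance at most [S], so the logarithm of the threshold exceeds the mean by at least
    b h + z. Each contribution is at most exp(-(t + 1)). *)
Lemma prXY_setT_le : \forall t \near +oo,
  prXY X Y setT (expR (q2S * t `^ (1 / 2) + (D 2 + 1 + `|hw_mu0 w|) * t `^ m)) <= expR (- t).
Proof.
near=> t.
have t1 : 1 <= t by [].
have t0 : 0 < t by exact: lt_le_trans t1.
set y := expR _.
have z1 : 1 <= t `^ m by near: t; apply: near_le_powR; exact: m_gt0.
have zS : Num.sqrt S <= t `^ m by near: t; apply: near_le_powR; exact: m_gt0.
(* This makes the cross term of (b h + z)^2 / (2 S) at least 1, giving the exponent t + 1. *)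
have Abig : 2 * S / (2 * q2S) <= t `^ (1 / 2 + m).
  by near: t; apply: near_le_powR; have := m_gt0; lra.
have ux : hw_u w <= xq (2 * t) by near: t; exact: near_u_le_xq.
have c1 : [set: R] `<=` `]-oo, 0] `|` `]0, +oo[%classic.
  by move=> x _; rewrite /= !in_itv/= andbT; case: leP => ?; [left|right].
have c2 : `]0, +oo[ `<=` `]xq (2 * t), +oo[ `|` `]0, xq (2 * t)]%classic.
  by move=> x /=; rewrite !in_itv/= !andbT => ->; case: leP => ?; [right|left].
apply: le_trans (prXY_le_split X Y y _ _ _ c1) _ => //.
rewrite (prX_nonpos hXY) add0r; apply: le_trans (prXY_le_split X Y y _ _ _ c2) _ => //.
rewrite xq_tail ?mulr_gt0//.
have q : q2S * t `^ (1 / 2) + t `^ m <= ln y - (hw_mu0 w + D 2 * t `^ m).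
  rewrite expRK; have := ler_norm (hw_mu0 w).
  set n := `|_| => nm; have n0 : 0 <= n by exact: normr_ge0.
  have : n <= n * t `^ m by rewrite ler_peMr.
  lra.
have q0 : 0 <= q2S * t `^ (1 / 2) by rewrite mulr_ge0 ?powR_ge0// ltW// q2S_gt0.
have e3 := @prXY_le_tail _ _ _ _ _ _ _ hXY `]0, xq (2 * t)] y S (hw_mu0 w + D 2 * t `^ m) _ S_gt0 _ _ _ _.
have {}e3 : prXY X Y `]0, xq (2 * t)] y <= expR (- (t + 1)).
  apply: le_trans (e3 _ _ _ _ _) _.
  - by [].
  - by move=> x; rewrite /= in_itv/= => /andP[x0 _]; rewrite hw_sigma_sqr_le// ltW.
  - by move=> x; rewrite /= in_itv/= => /andP[x0 xx]; exact: hw_mu_le_xq.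
  - lra.
  - exact: expR_gt0.
  rewrite (le_trans (ler_piMr _ _)) ?expR_ge0//.
    exact: prX_le1.
  rewrite ler_expR lerN2 ler_pdivlMr ?mulr_gt0 ?S_gt0//.
  move: Abig; rewrite ler_pdivrMr ?mulr_gt0 ?q2S_gt0// powR_half_m//.
  have := powR_half_sqr t0; have := q2S_sqr; have := q2S_gt0.
  move: q q0 z1; set a := ln y - _; set h := t `^ _; set z := t `^ m; set b := q2S.
  move=> q q0 z1 b0 bb hh Abig; rewrite expr2.
  have : (b * h + z) * (b * h + z) <= a * a by apply: ler_pM => //; lra.
  have : b * h * (b * h) = 2 * S * t by rewrite -hh -bb; ring.
  nra.
apply: (@le_trans _ _ (expR (- (t + 1)) + expR (- (t + 1)))).
  apply: lerD => //; rewrite ler_expR; lra.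
apply: le_trans (expR_double_le _) _.
by rewrite ler_expR; lra.
Unshelve. all: by end_near. Qed.
Lemma near_powR_m_le (c : R) : \forall t \near +oo, c * t `^ m <= t `^ (1 / 2).
Proof. by apply: near_powR_le_powR; exact: m_lt. Qed.

(** X is confined to a window at t^(-1/2). The variance deficit, the mass of the window and the
    prefactors cost O(h) in the exponent; lowering the logarithm of the threshold by z = t^m gains
    [kap] h z, which wins because z tends to infinity. *)
Lemma prXY_setT_gt : \forall t \near +oo,
  expR (- t) < prXY X Y setT (expR (q2S * t `^ (1 / 2) - t `^ m)).
Proof.
(* From exp(-a) >= 1 - a at x <= 2 t^(-1/2): the variance is at least S - g t^(-1/2). *)
pose g := 2 * hw_sigma1 w * hw_sigma2 w.
pose al := hw_alpha w.
have al0 : 0 < al := hw_alpha_gt0 adm.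
have u0 := hw_u_gt0 adm.
have g0 : 0 <= g by rewrite !mulr_ge0// ltW// hw_sigma2_gt0.
pose c1 := (2 * Num.sqrt (2 * pi) * al)^-1.
pose c2 := (2 * Num.sqrt (2 * pi) * Num.sqrt S)^-1.
have sp : 0 < Num.sqrt (2 * pi) :> R by exact: lt_le_trans ltr01 (sqrt_2pi_ge1 R).
have c10 : 0 < c1 by rewrite invr_gt0 !mulr_gt0.
have c20 : 0 < c2 by rewrite invr_gt0 !mulr_gt0// sqrtr_gt0 S_gt0.
pose K := ln 2 - hw_mu0 w.
(* The first summand comes from (ln t / 2 + theta)^2 <= (ln t)^2 / 2 + 2 theta^2 and (ln t)^2 <=
   h. *)
pose c3 := (2^-1 + 2 * hw_theta w ^+ 2) / (2 * al ^+ 2) + `|ln c1| + `|ln c2|.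
pose kap := q2S / (4 * S).
have b0 := q2S_gt0.
have kap0 : 0 < kap by rewrite divr_gt0 ?mulr_gt0 ?S_gt0.
have half0 : (0 : R) < 1 / 2 by lra.
near=> t.
have t1 : 1 <= t by [].
have t0 : 0 < t by exact: lt_le_trans t1.
have hu : 2 / hw_u w <= t `^ (1 / 2) by near: t; exact: near_le_powR.
have hth : 2 / expR (hw_theta w) <= t `^ (1 / 2) by near: t; exact: near_le_powR.
have h2 : 2 <= t `^ (1 / 2) by near: t; exact: near_le_powR.
have hW : 2 * g / S <= t `^ (1 / 2) by near: t; exact: near_le_powR.
have hmu : 2 / q2S * (hw_mu0 w + hw_mu1 w) <= t `^ (1 / 2) by near: t; exact: near_le_powR.
have hz : 2 / q2S * t `^ m <= t `^ (1 / 2) by near: t; exact: near_powR_m_le.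
have zK : 2 * `|K| <= t `^ m by near: t; apply: near_le_powR; exact: m_gt0.
have zc : (2 * g / S + c3 + 1) / kap <= t `^ m by near: t; apply: near_le_powR; exact: m_gt0.
have lnt : 1 * ln t <= t `^ (1 / 4) by near: t; apply: near_ln_le_powR; lra.
set h := t `^ (1 / 2) in hu hth h2 hW hmu hz *.
set z := t `^ m in hz zK zc *; set y := expR (_ - _).
have h0 : 0 < h by exact: powR_gt0.
have z0 : 0 < z by exact: powR_gt0.
have ht : h * h = t by exact: powR_half_sqr.
pose dl := h^-1.
have dl0 : 0 < dl by rewrite invr_gt0.
have du : 2 * dl <= hw_u w by rewrite ler_pdivrMr// mulrC -ler_pdivrMr.
have dth : ln (2 * dl) <= hw_theta w.
  rewrite -(expRK (hw_theta w)) ler_ln ?posrE ?mulr_gt0 ?expR_gt0//.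
  by rewrite ler_pdivrMr// mulrC -ler_pdivrMr// expR_gt0.
have d1 : 2 * dl <= 1 by rewrite ler_pdivrMr// mul1r.
pose W := S - g * h^-1.
have SW : S / 2 <= W.
  have : g * h^-1 <= S / 2.
    move: hW; rewrite !ler_pdivrMr ?S_gt0//. lra.
  rewrite /W; lra.
have W0 : 0 < W by have := S_gt0; lra.
have zb : z <= q2S * h / 2.
  move: hz; rewrite mulrAC ler_pdivrMr// mulrC; lra.
have lny : ln y = q2S * h - z by rewrite expRK.
have muy : hw_mu0 w + hw_mu1 w <= ln y.
  rewrite lny; move: hmu; rewrite mulrAC ler_pdivrMr// [h * _]mulrC; lra.
have pX := prX_small hXY dl0 du dth.
have sV x : `]dl, 2 * dl]%classic x -> W <= hw_sigma w x ^+ 2 <= S.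
  rewrite /= in_itv/= => /andP[dx xd]; have x0 : 0 < x by exact: lt_trans dx.
  rewrite hw_sigma_sqr_le ?(ltW x0)// andbT (hw_sigma_sqr hXY).
  have := expR_ge1Dx (- (hw_sigma2 w * x)); rewrite -(ler_pM2l s1_gt0).
  have : hw_sigma1 w * (hw_sigma2 w * x) <= hw_sigma1 w * (hw_sigma2 w * (2 * dl)).
    by rewrite !ler_pM2l// hw_sigma2_gt0.
  rewrite /W /S /g -/dl; lra.
have mV x : `]dl, 2 * dl]%classic x -> hw_mu w x <= ln y.
  rewrite /= in_itv/= => /andP[dx xd]; apply: le_trans muy.
  rewrite lerD2l ler_piMr ?(ltW (hw_mu1_gt0 adm))//.
  apply: (@le_trans _ _ (1 `^ hw_mu2 w)); last by rewrite powR1.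
  (* The window lies below 1, so mu is at most mu0 + mu1 there. *)
  apply: ge0_ler_powR; rewrite ?nnegrE ?(ltW (hw_mu2_gt0 adm))//; lra.
have pXY := @prXY_ge_tail _ _ _ _ _ _ _ hXY `]dl, 2 * dl] y S W (@measurable_itv _ _) W0 (expR_gt0 _) sV mV.
apply: lt_le_trans (prXY_le X Y _ _ (@subsetT _ `]dl, 2 * dl]) (lexx y)) => //.
apply: lt_le_trans pXY.
rewrite -/c2 lny; set e1 := _ ^+ 2 / _.
move: pX; rewrite -/c1; set e2 := _ / _ => pX.
apply: lt_le_trans (ler_wpM2l _ pX); last by rewrite mulr_ge0 ?expR_ge0// ltW.
have e1E : e1 <= t + 2 * g / S * h - kap * (h * z).
  apply: exponent_le_inflated => //; rewrite ?S_gt0 ?q2S_sqr//.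
  - have := ler_norm (- K); rewrite normrN /K; lra.
  - have := ler_norm K; rewrite /K; lra.
have e2E : e2 <= (2^-1 + 2 * hw_theta w ^+ 2) / (2 * al ^+ 2) * h.
  rewrite /e2 [leRHS]mulrAC ler_pM2r ?invr_gt0 ?mulr_gt0 ?exprn_gt0//.
  have -> : ln dl = - (ln t / 2).
    by rewrite /dl lnV ?posrE// /h ln_powR; congr (- _); rewrite mulrC mul1r.
  have l0 : 0 <= ln t by exact: ln_ge0.
  have l2 : ln t * ln t <= h.
    have -> : h = t `^ (1 / 4) * t `^ (1 / 4).
      by rewrite -powRD ?(gt_eqF t0) ?implybT//; rewrite (_ : 1 / 4 + 1 / 4 = 1 / 2 :> R)//; lra.
    by rewrite mul1r in lnt; exact: ler_pM.
  have th2 : hw_theta w ^+ 2 <= hw_theta w ^+ 2 * h.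
    by apply: ler_peMr; [exact: sqr_ge0|lra].
  move: th2 l2; rewrite !expr2; set a := ln t; set b := hw_theta w.
  have := sqr_ge0 (a / 2 - b); rewrite expr2; nra.
rewrite -{1}(lnK (_ : c2 \is Num.pos)) ?posrE// -{1}(lnK (_ : c1 \is Num.pos)) ?posrE//.
rewrite -!expRD ltr_expR.
have n1 := ler_norm (- ln c1); have n2 := ler_norm (- ln c2).
rewrite !normrN in n1 n2.
have n1h : `|ln c1| <= `|ln c1| * h by apply: ler_peMr => //; lra.
have n2h : `|ln c2| <= `|ln c2| * h by apply: ler_peMr => //; lra.
move: zc; rewrite ler_pdivrMr// => zc.
have : (2 * g / S + c3 + 1) * h <= z * kap * h by rewrite ler_pM2r.
rewrite /c3; set gS := 2 * g / S.
move: n1h n2h n1 n2 e1E e2E; rewrite -/gS.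
set l1 := `|ln c1|; set l2 := `|ln c2|; set th := _ / _ => *; lra.
Unshelve. all: by end_near. Qed.
Lemma le_q2S_half c h : 2 / q2S * c <= h -> c <= q2S * h / 2.
Proof. by rewrite mulrAC ler_pdivrMr ?q2S_gt0// [h * _]mulrC; lra. Qed.

(** X is confined between its quantiles at t and t + 1. This window has mass at least exp(-(t + 1)),
    the variance there is at least sigma0, and the mean is still O(t^m), hence below the logarithm
    of the threshold. *)
Lemma near_prXY_ge (B : R) : 0 <= B -> exists C, \forall t \near +oo,
  expR (- (2 + r) * t - C * t `^ (1 / 2 + m)) <=
  prXY X Y `]xq t, +oo[ (expR (q2S * t `^ (1 / 2) + B * t `^ m)).
Proof.
move=> B0; have b0 := q2S_gt0; have m0 := m_gt0.
have half0 : (0 : R) < 1 / 2 by lra.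
pose c2 := (2 * Num.sqrt (2 * pi) * Num.sqrt S)^-1.
have sp : 0 < Num.sqrt (2 * pi) :> R by exact: lt_le_trans ltr01 (sqrt_2pi_ge1 R).
have c20 : 0 < c2 by rewrite invr_gt0 !mulr_gt0// sqrtr_gt0 S_gt0.
pose K := ln 2 - hw_mu0 w.
pose C0 := (2 * (B + 1) * q2S + (B + 1) ^+ 2) / (2 * hw_sigma0 w).
(* The summands pay for the Gaussian exponent, the prefactor and the extra unit in exp(-(t + 1)). *)
exists (C0 + `|ln c2| + 1); near=> t.
have t1 : 1 <= t by [].
have t0 : 0 < t by exact: lt_le_trans t1.
have ux : hw_u w <= xq (1 * t) by near: t; exact: near_u_le_xq.
have hmu : 2 / q2S * hw_mu0 w <= t `^ (1 / 2) by near: t; exact: near_le_powR.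
have hz : 2 / q2S * D 2 * t `^ m <= t `^ (1 / 2) by near: t; exact: near_powR_m_le.
have hK : 2 / q2S * - K <= t `^ (1 / 2) by near: t; exact: near_le_powR.
have zK : `|K| <= t `^ m by near: t; exact: near_le_powR.
have zz : 1 * (t `^ m * t `^ m) <= t `^ (1 / 2 + m) by near: t; exact: near_sqr_powR_m.
have A1 : 1 <= t `^ (1 / 2 + m) by near: t; apply: near_le_powR; lra.
rewrite mul1r in ux.
rewrite powR_half_m// in A1 zz *.
set h := t `^ (1 / 2) in hmu hz hK zz A1 *.
set z := t `^ m in hz zK zz A1 *; set y := expR (q2S * h + _).
have h0 : 0 < h by exact: powR_gt0.
have z0 : 0 < z by exact: powR_gt0.
have ht : h * h = t by exact: powR_half_sqr.
have lny : ln y = q2S * h + B * z by rewrite expRK.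
have Bz : 0 <= B * z by rewrite mulr_ge0// ltW.
have xx : xq t <= xq (t + 1).
  rewrite ler_pM2l// ge0_ler_powR ?nnegrE ?invr_ge0 ?(ltW k_gt0)//; lra.
have ux' := le_trans ux xx.
have pX : expR (- (t + 1)) <= prX X `]xq t, xq (t + 1)].
  have : `]xq t, +oo[ `<=` `]xq (t + 1), +oo[ `|` `]xq t, xq (t + 1)]%classic.
    by move=> x /=; rewrite !in_itv/= !andbT => ->; case: leP => ?; [right|left].
  move=> /(prX_le_split X (@measurable_itv _ _) (@measurable_itv _ _) (@measurable_itv _ _)).
  rewrite !xq_tail//; last by lra.
  have := expR_double_le (- (t + 1)); rewrite (_ : - (t + 1) + 1 = - t); last by ring.
  lra.
have xp x : `]xq t, xq (t + 1)]%classic x -> 0 < x.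
  rewrite /= in_itv/= => /andP[+ _]; apply: lt_trans.
  by apply: lt_le_trans ux; exact: hw_u_gt0.
have sV x : `]xq t, xq (t + 1)]%classic x -> hw_sigma0 w <= hw_sigma w x ^+ 2 <= S.
  move=> /xp x0; rewrite hw_sigma_sqr_le ?(ltW x0)// andbT (hw_sigma_sqr hXY) ltW//.
  exact: (hw_var_gt0 hXY).
have mV x : `]xq t, xq (t + 1)]%classic x -> hw_mu w x <= ln y.
  move=> xA; have x0 := xp x xA; move: xA; rewrite /= in_itv/= => /andP[_ xx1].
  have : x <= xq (2 * t).
    apply: le_trans xx1 _; rewrite ler_pM2l// ge0_ler_powR ?nnegrE ?invr_ge0 ?(ltW k_gt0)//; lra.
  move=> /(hw_mu_le_xq (ltr0Sn _ 1) t0 x0) h1.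
  apply: (le_trans h1); rewrite lny -/z.
  rewrite -mulrA in hz; have := le_q2S_half hmu; have := le_q2S_half hz.
  move: Bz; set bz := B * z; set dz := D 2 * z; lra.
have pXY := prXY_ge_tail hXY (@measurable_itv _ _) s0_gt0 (expR_gt0 _) sV mV.
apply: le_trans (prXY_le X Y (@measurable_itv _ `]xq t, xq (t + 1)]) _ _ (lexx y)) => //; last first.
  by move=> x; rewrite /= !in_itv/= andbT => /andP[].
apply: le_trans pXY.
rewrite -/c2 lny; set e1 := _ ^+ 2 / _.
apply: le_trans (ler_wpM2l _ pX); last by rewrite mulr_ge0 ?expR_ge0// ltW.
have e1E : e1 <= (1 + r) * t + C0 * (h * z).
  apply: (exponent_le s0_gt0 s1_gt0 b0 h0 z0 ht q2S_sqr B0 zK).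
  - by rewrite mul1r in zz.
  - by rewrite /K; ring.
  - have := le_q2S_half hK; have : 0 < q2S * h by rewrite mulr_gt0.
    rewrite /K; move: Bz; set bz := B * z; lra.
rewrite -[c2 in leRHS]lnK ?posrE// -!expRD ler_expR.
have n2 := ler_norm (- ln c2).
rewrite normrN in n2.
have n2h : `|ln c2| <= `|ln c2| * (h * z) by apply: ler_peMr.
move: n2h n2 e1E A1 ; set l2 := `|ln c2|; set hz' := h * z; set rr := r; set cc := C0 => *; lra.
Unshelve. all: by end_near. Qed.

(** X is split at [xq (N * t)]. Between [xq t] and this point the variance is at most sigma0 plus an
    exponentially small term in [xq t]; the mass exp(-t) times the log-normal tail gives the rate 2
    + r. *)
Lemma near_prXY_le : exists C, \forall t \near +oo,
  prXY X Y `]xq t, +oo[ (expR (q2S * t `^ (1 / 2) - t `^ m)) <=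
  expR (- (2 + r) * t + C * t `^ (1 / 2 + m)).
Proof.
have b0 := q2S_gt0; have m0 := m_gt0.
have half0 : (0 : R) < 1 / 2 by lra.
have r0 : 0 < r by exact: divr_gt0.
(* As N > 2 + r, the probability exp(-N t) beyond the split is within the claimed bound. *)
pose N := 3 + r.
have N0 : 0 < N by rewrite addr_gt0.
(* Collects the mean shift, the z subtracted in the threshold, and mu0. *)
pose E := D N + 1 + `|hw_mu0 w|.
have E0 : 0 < E by rewrite ltr_wpDr// ltr_wpDl// D_ge0.
pose C1 := r * (1 + r) + E * q2S / hw_sigma0 w.
have C10 : 0 < C1.
  apply: addr_gt0; first by rewrite mulr_gt0// addr_gt0.
  by rewrite divr_gt0// mulr_gt0.
exists (C1 + 1); near=> t.
have t1 : 1 <= t by [].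
have t0 : 0 < t by exact: lt_le_trans t1.
have ux : hw_u w <= xq (1 * t) by near: t; exact: near_u_le_xq.
have uxN : hw_u w <= xq (N * t) by near: t; exact: near_u_le_xq.
have hE : 2 / q2S * E * t `^ m <= t `^ (1 / 2) by near: t; exact: near_powR_m_le.
have hS : 2 / q2S * Num.sqrt S <= t `^ (1 / 2) by near: t; exact: near_le_powR.
have z1 : 1 <= t `^ m by near: t; exact: near_le_powR.
have A1 : 1 <= t `^ (1 / 2 + m) by near: t; apply: near_le_powR; lra.
(* Equivalent to t exp(-sigma2 xq(t)) <= 1, which yields the bound on e t required by
   [exponent_ge]. *)
have lnt : (hw_sigma2 w * hw_lambda w)^-1 * ln t <= t `^ (hw_k w)^-1.
  by near: t; apply: near_ln_le_powR; rewrite invr_gt0.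
rewrite mul1r in ux.
rewrite powR_half_m// in A1 *.
set h := t `^ (1 / 2) in hE hS A1 *.
set z := t `^ m in hE z1 A1 *; set y := expR (q2S * h - _).
have h0 : 0 < h by exact: powR_gt0.
have z0 : 0 < z by exact: powR_gt0.
have ht : h * h = t by exact: powR_half_sqr.
have lny : ln y = q2S * h - z by rewrite expRK.
pose e := expR (- (hw_sigma2 w * xq t)).
have et : e * t <= h * z.
  apply: le_trans A1; rewrite /e expRN mulrC ler_pdivrMr ?expR_gt0// mul1r.
  rewrite -{1}(lnK (_ : t \is Num.pos)) ?posrE// ler_expR.
  by move: lnt; rewrite ler_pdivrMl ?mulr_gt0 ?(hw_sigma2_gt0 adm)// /xq mulrA.
pose V := hw_sigma0 w + hw_sigma1 w * e.
have V0 : 0 < V by rewrite addr_gt0// mulr_gt0// expR_gt0.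
have xq0 : 0 < xq t by apply: lt_le_trans ux; exact: hw_u_gt0.
have VS : V <= S.
  rewrite lerD2l ler_piMr ?(ltW s1_gt0)// expR_le1 oppr_le0 mulr_ge0// ?(ltW xq0)//.
  by rewrite ltW// hw_sigma2_gt0.
have xp x : `]xq t, xq (N * t)]%classic x -> xq t < x.
  by rewrite /= in_itv/= => /andP[].
have sV x : `]xq t, xq (N * t)]%classic x -> hw_sigma w x ^+ 2 <= V.
  move=> /xp /ltW xx; rewrite (hw_sigma_sqr hXY) lerD2l ler_pM2l// ler_expR lerN2.
  by rewrite ler_pM2l// hw_sigma2_gt0.
have mV x : `]xq t, xq (N * t)]%classic x -> hw_mu w x <= hw_mu0 w + D N * z.
  move=> xA; have x0 := xp x xA; move: xA; rewrite /= in_itv/= => /andP[_ xx1].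
  by apply: hw_mu_le_xq => //; exact: lt_trans x0.
have q : q2S * h - E * z <= ln y - (hw_mu0 w + D N * z).
  rewrite lny; have := ler_norm (hw_mu0 w); rewrite /E.
  set n := `|_| => nm; have n0 : 0 <= n by exact: normr_ge0.
  have : n <= n * z by rewrite ler_peMr.
  lra.
have hE' : E * z <= q2S * h / 2.
  by apply: le_q2S_half; rewrite mulrA.
have hS' : Num.sqrt S <= q2S * h / 2.
  exact: le_q2S_half.
have Sq : Num.sqrt V <= ln y - (hw_mu0 w + D N * z).
  apply: (le_trans (ler_wsqrtr VS)); apply: le_trans q; move: hE' hS'; set a := E * z; lra.
have pXY := prXY_le_tail hXY (@measurable_itv _ _) V0 sV mV Sq (expR_gt0 _).
have c2 : `]xq t, +oo[ `<=` `]xq (N * t), +oo[ `|` `]xq t, xq (N * t)]%classic.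
  by move=> x /=; rewrite !in_itv/= !andbT => ->; case: leP => ?; [right|left].
apply: le_trans (prXY_le_split X Y y _ _ _ c2) _ => //.
rewrite xq_tail ?mulr_gt0//.
have pX : prX X `]xq t, xq (N * t)] <= expR (- t).
  rewrite -xq_tail//; apply: prX_le => // x.
  by rewrite /= !in_itv/= andbT => /andP[].
have e1 := exponent_ge s0_gt0 s1_gt0 b0 h0 z0 ht q2S_sqr (ltW E0) (expR_ge0 _) et _ q.
have {}e1 : (1 + r) * t - C1 * (h * z) <= (ln y - (hw_mu0 w + D N * z)) ^+ 2 / (2 * V).
  by apply: e1; move: hE'; set a := E * z => ?; have : 0 <= q2S * h; [rewrite mulr_ge0// ltW|lra].
have hz0 : 0 <= h * z by rewrite mulr_ge0// ltW.
have Chz : 0 <= C1 * (h * z) by rewrite mulr_ge0// ltW.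
apply: (@le_trans _ _ (expR (- (2 + r) * t + C1 * (h * z)) + expR (- (2 + r) * t + C1 * (h * z)))).
  apply: lerD.
    rewrite ler_expR /N; move: Chz; set a := C1 * _; set x := r; lra.
  apply: (le_trans pXY); apply: le_trans (ler_wpM2l (expR_ge0 _) pX) _.
  rewrite -expRD ler_expR; move: e1; set a := C1 * _; set x := r; set q' := _ / _; lra.
apply: (le_trans (expR_double_le _)); rewrite ler_expR.
move: A1; set hz := h * z; set a := C1; lra.
Unshelve. all: by end_near. Qed.

(** * Quantiles, the joint tail at quantile level and the two coefficients *)

Let B := D 2 + 1 + `|hw_mu0 w|.
Let joint t := prXY X Y `]quantile X (std_exponential_cdf t), +oo[
  (quantile Y (std_exponential_cdf t)).

Lemma std_exponential_cdf_gt0 (t : R) : 0 < t -> 0 < std_exponential_cdf t.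
Proof. by move=> t0; rewrite subr_gt0 expR_lt1 oppr_lt0. Qed.

Lemma std_exponential_cdf_lt1 (t : R) : std_exponential_cdf t < 1.
Proof. by rewrite gtrBl expR_gt0. Qed.

Lemma near_quantileX :
  \forall t \near +oo, quantile X (std_exponential_cdf t) = xq t.
Proof. by near=> t; apply: (quantile_hwX hXY). Unshelve. all: by end_near. Qed.

Lemma near_quantileY : \forall t \near +oo,
  expR (q2S * t `^ (1 / 2) - t `^ m) <= quantile Y (std_exponential_cdf t)
    <= expR (q2S * t `^ (1 / 2) + B * t `^ m).
Proof.
near=> t; have t0 : 0 < t by [].
apply/andP; split.
  apply: quantile_ge; first exact: std_exponential_cdf_lt1.
  move=> y yx; rewrite (cdf_prY X) lte_fin ltrD2l ltrN2.
  apply: lt_le_trans (prXY_le X Y measurableT measurableT (@subset_refl _ _) (ltW yx)).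
  by near: t; exact: prXY_setT_gt.
apply: quantile_le; first exact: std_exponential_cdf_gt0.
rewrite (cdf_prY X) lee_fin lerD2l lerN2.
by near: t; exact: prXY_setT_le.
Unshelve. all: by end_near. Qed.

Lemma near_joint : exists C, \forall t \near +oo,
  expR (- (2 + r) * t - C * t `^ (1 / 2 + m)) <= joint t <=
  expR (- (2 + r) * t + C * t `^ (1 / 2 + m)).
Proof.
have B0 : 0 <= B by rewrite !addr_ge0// D_ge0.
have [C1 H1] := near_prXY_ge B0; have [C2 H2] := near_prXY_le.
exists (Num.max C1 C2); near=> t.
have A0 : 0 <= t `^ (1 / 2 + m) by exact: powR_ge0.
have qX : quantile X (std_exponential_cdf t) = xq t by near: t; exact: near_quantileX.
have /andP[qY1 qY2] : expR (q2S * t `^ (1 / 2) - t `^ m) <= quantile Y (std_exponential_cdf t)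
    <= expR (q2S * t `^ (1 / 2) + B * t `^ m) by near: t; exact: near_quantileY.
rewrite /joint qX; apply/andP; split.
  apply: le_trans (prXY_le X Y _ _ (@subset_refl _ _) qY2) => //.
  apply: (@le_trans _ _ (expR (- (2 + r) * t - C1 * t `^ (1 / 2 + m)))).
    by rewrite ler_expR lerD2l lerN2 ler_wpM2r// le_max lexx.
  by near: t.
apply: le_trans (prXY_le X Y _ _ (@subset_refl _ _) qY1) _ => //.
apply: (@le_trans _ _ (expR (- (2 + r) * t + C2 * t `^ (1 / 2 + m)))); first by near: t.
by rewrite ler_expR lerD2l ler_wpM2r// le_max lexx orbT.
Unshelve. all: by end_near. Qed.

Lemma near_ln_joint : exists C, \forall t \near +oo,
  0 < joint t /\ `|ln (joint t) + (2 + r) * t| <= C * t `^ (1 / 2 + m).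
Proof.
have [C H] := near_joint; exists C; near=> t.
have /andP[h1 h2] : expR (- (2 + r) * t - C * t `^ (1 / 2 + m)) <= joint t <=
  expR (- (2 + r) * t + C * t `^ (1 / 2 + m)) by near: t.
have j0 : 0 < joint t by apply: lt_le_trans h1; exact: expR_gt0.
split=> //; move: h1 h2.
rewrite -{1 2}(lnK (_ : joint t \is Num.pos)) ?posrE// !ler_expR ler_norml.
rewrite mulNr; set a := (2 + r) * t; set c := C * _; set l := ln _ => h1 h2.
by apply/andP; split; lra.
Unshelve. all: by end_near. Qed.


Lemma joint_setE t : fine (P ([set z | quantile X (std_exponential_cdf t) < X z] `&`
    [set z | quantile Y (std_exponential_cdf t) < Y z])) = joint t.
Proof.
rewrite /joint /prXY; congr (fine (P (_ `&` _))); apply/seteqP; split => z /=;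
  by rewrite in_itv/= andbT.
Qed.

(** The denominator is exactly exp(-t), since the quantile of X lies in the Weibull part. *)
Lemma near_chi_level : \forall t \near +oo,
  chi_level X Y (std_exponential_cdf t) = joint t / expR (- t).
Proof.
near=> t; have t0 : 0 < t by [].
have qX : quantile X (std_exponential_cdf t) = xq t by near: t; exact: near_quantileX.
rewrite /chi_level /cond_prob setIC joint_setE; congr (_ / _).
rewrite -xq_tail//.
  rewrite -qX /prX; congr (fine (P _)); apply/seteqP; split => z /=;
  by rewrite in_itv/= andbT.
have : hw_u w <= xq (1 * t) by near: t; exact: near_u_le_xq.
by rewrite mul1r.
Unshelve. all: by end_near. Qed.

Lemma cvg_ln_joint : ln (joint t) / (- t) @[t --> +oo] --> 2 + r.
Proof.
have [C H] := near_ln_joint.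
apply/cvgrPdist_le => /= e e0; near=> t.
have t0 : 0 < t by [].
have [j0 Hj] : 0 < joint t /\ `|ln (joint t) + (2 + r) * t| <= C * t `^ (1 / 2 + m) by near: t.
have -> : 2 + r - ln (joint t) / - t = (ln (joint t) + (2 + r) * t) / t.
  by rewrite invrN mulrN opprK mulrDl mulfK ?gt_eqF// addrC.
rewrite normrM normfV (gtr0_norm t0) ler_pdivrMr//; apply: (le_trans Hj).
have : C / e * t `^ (1 / 2 + m) <= t `^ 1.
  by near: t; apply: near_powR_le_powR; have := m_lt; lra.
by rewrite powRr1 ?(ltW t0)// mulrAC ler_pdivrMr// [e * t]mulrC.
Unshelve. all: by end_near. Qed.

Lemma cvg_chi_level : chi_level X Y (std_exponential_cdf t) @[t --> +oo] --> 0.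
Proof.
have r0 : 0 < r by exact: divr_gt0.
have [C H] := near_ln_joint.
apply/cvgrPdist_le => /= e e0; near=> t.
have t0 : 0 < t by [].
have [j0 Hj] : 0 < joint t /\ `|ln (joint t) + (2 + r) * t| <= C * t `^ (1 / 2 + m) by near: t.
have -> : chi_level X Y (std_exponential_cdf t) = joint t / expR (- t).
  by near: t; exact: near_chi_level.
rewrite sub0r normrN ger0_norm ?divr_ge0 ?expR_ge0 ?(ltW j0)//.
rewrite -expRN opprK -{1}(lnK (_ : joint t \is Num.pos)) ?posrE// -expRD.
rewrite -[leRHS]lnK ?posrE// ler_expR.
(* The error is at most r t, so the logarithm of chi is at most -(1 + r) t + r t = -t. *)
have : C / r * t `^ (1 / 2 + m) <= t `^ 1.
  by near: t; apply: near_powR_le_powR; have := m_lt; lra.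
rewrite powRr1 ?(ltW t0)// mulrAC ler_pdivrMr//.
have : - ln e <= t by [].
have := le_trans (ler_norm _) Hj.
set x := r; set a := C * _; lra.
Unshelve. all: by end_near. Qed.

(** The substitution t = -ln(1 - p) inverts p = 1 - exp(-t) and turns limits at infinity into limits
    as p increases to 1. *)
Lemma cvg_oppr_ln1B : - ln (1 - p) @[p --> (1 : R)^'-] --> +oo.
Proof.
apply/cvgryPge => A; near=> p.
have p1 : p < 1 by [].
rewrite lerNr -(expRK (- A)) ler_ln ?posrE ?expR_gt0 ?subr_gt0//.
rewrite lerBlDr -lerBlDl ltW//.
by near: p; apply: nbhs_left_gt; rewrite gtrBl expR_gt0.
Unshelve. all: by end_near. Qed.

Lemma hw_asymptotic_dependence : is_asymptotic_dependence_coef X Y 0.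
Proof.
have := cvg_comp _ _ cvg_oppr_ln1B cvg_chi_level; apply: cvg_trans.
apply: near_eq_cvg; near=> p; have p1 : p < 1 by [].
by rewrite /= /std_exponential_cdf opprK lnK ?posrE ?subr_gt0// opprB addrC subrK.
Unshelve. all: by end_near. Qed.

(** Multiplying chi by 1 - p restores the joint tail, so the ratio is the inverse of the one in
    [cvg_ln_joint]. *)
Lemma hw_asymptotic_independence : is_asymptotic_independence_coef X Y (2 + r)^-1.
Proof.
have r2 : 2 + r != 0 by rewrite gt_eqF// addr_gt0// divr_gt0.
have jc : (- t) / ln (expR (- t) * chi_level X Y (std_exponential_cdf t))
    @[t --> +oo] --> (2 + r)^-1.
  apply: cvg_trans (cvgV r2 cvg_ln_joint); apply: near_eq_cvg; near=> t.
  have -> : chi_level X Y (std_exponential_cdf t) = joint t / expR (- t).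
    by near: t; exact: near_chi_level.
  by rewrite /= invf_div [expR _ * _]mulrC divfK// gt_eqF// expR_gt0.
have := cvg_comp _ _ cvg_oppr_ln1B jc; apply: cvg_trans.
apply: near_eq_cvg; near=> p; have p1 : p < 1 by [].
rewrite /= /std_exponential_cdf opprK lnK ?posrE ?subr_gt0//.
by rewrite (_ : 1 - (1 - p) = p)//; ring.
Unshelve. all: by end_near. Qed.

Lemma hw_joint_tail : exists h : R -> R,
  h =O_+oo (fun t : R => t `^ (1 / 2 + m)) /\
  \forall t \near +oo,
    fine (P ([set z | quantile X (std_exponential_cdf t) < X z] `&`
             [set z | quantile Y (std_exponential_cdf t) < Y z])) =
    expR (- (2 + r) * t + h t).
Proof.
have [C H] := near_ln_joint.
exists (fun t => ln (joint t) + (2 + r) * t); split.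
  (* The Landau constant has to be positive, whereas the sign of [C] is unknown. *)
  apply/eqO_exP; exists (`|C| + 1); first by rewrite ltr_wpDl.
  near=> t.
  have [j0 Hj] : 0 < joint t /\ `|ln (joint t) + (2 + r) * t| <= C * t `^ (1 / 2 + m) by near: t.
  apply: (le_trans Hj); rewrite [X in _ <= _ * X]ger0_norm ?powR_ge0// ler_wpM2r ?powR_ge0//.
  by rewrite (le_trans (ler_norm C))// lerDl.
near=> t.
have [j0 _] : 0 < joint t /\ `|ln (joint t) + (2 + r) * t| <= C * t `^ (1 / 2 + m) by near: t.
rewrite joint_setE -{1}(lnK (_ : joint t \is Num.pos)) ?posrE//; congr expR; ring.
Unshelve. all: by end_near. Qed.

End hw_asymptotics.

Theorem mainTheorem4 (d : measure_display) (T : measurableType d)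
    (R : realType) (P : probability T R) (w : hw_param R)
    (X Y : {RV P >-> R}) (hXY : haver_winterstein w X Y)
    (hmu2_gt0 : 0 < hw_mu2 w) (hmu2_lt : hw_mu2 w < 1 / 2)
    (hmu2_k : 2 * hw_mu2 w < hw_k w) :
  [/\ exists h : R -> R,
        h =O_+oo (fun t : R => t `^ (1 / 2 + hw_mu2 w / hw_k w)) /\
        \forall t \near +oo,
          fine (P ([set z | quantile X (std_exponential_cdf t) < X z] `&`
                   [set z | quantile Y (std_exponential_cdf t) < Y z])) =
          expR (- (2 + hw_sigma1 w / hw_sigma0 w) * t + h t),
      is_asymptotic_dependence_coef X Y 0
    & is_asymptotic_independence_coef X Y
        (2 + hw_sigma1 w / hw_sigma0 w)^-1].
Proof.
split.
- exact: (hw_joint_tail hXY hmu2_k).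
- exact: (hw_asymptotic_dependence hXY hmu2_k).
- exact: (hw_asymptotic_independence hXY hmu2_k).
Qed.
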